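(* Let $p_1<p_2$ be finite real numbers, let $I$ be an open interval containing $[p_1,p_2]$, let $\rho>1$, $\mu\in(0,1]$ and $p_0\in I$. Suppose that $\psi:I\to\mathbb{R}$ satisfies Assumption (P$_{p_0,\rho}$) with non-vanishing factor $\tilde\psi$, and that $U:(p_1,p_2]\to\mathbb{C}$ satisfies Assumption (A$_{p_1,\mu}$) with regular factor $\tilde u$ (both assumptions are defined in the context). Moreover suppose that $\psi'$ is monotone on $\{p\in I : p<p_0\}$ and on $\{p\in I : p>p_0\}$. Then for all $\omega>0$, $$\left|\int_{p_1}^{p_2}U(p)\,e^{i\omega\psi(p)}\,dp\right|\leqslant C(U,\psi)\,\omega^{-\frac{\mu}{\rho}},$$ where $$C(U,\psi):=\frac{3}{\mu}\,\|\tilde u\|_{L^\infty(p_1,p_2)}+\left(8\,\|\tilde u\|_{L^\infty(p_1,p_2)}+2\,\|\tilde u'\|_{L^1(p_1,p_2)}\right)\left(\min_{p\in[p_1,p_2]}|\tilde\psi(p)|\right)^{-1}.$$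
   Context: Assumption (P$_{p_0,\rho}$) (with $p_0\in I$, $\rho>1$): $\psi:I\to\mathbb{R}$ belongs to $\mathcal{C}^1(I)\cap\mathcal{C}^2(I\setminus\{p_0\})$ and there exists a function $\tilde\psi:I\to\mathbb{R}$ such that $\psi'(p)=|p-p_0|^{\rho-1}\,\tilde\psi(p)$ for all $p\in I$, where $|\tilde\psi|$ is continuous on $I$ and does not vanish on $I$. The function $\tilde\psi$ is called the non-vanishing factor of $\psi$. Assumption (A$_{p_1,\mu}$) (with $\mu\in(0,1]$): for $U:(p_1,p_2]\to\mathbb{C}$ there exists $\tilde u:[p_1,p_2]\to\mathbb{C}$ such that $U(p)=(p-p_1)^{\mu-1}\,\tilde u(p)$ for all $p\in(p_1,p_2]$, where $\tilde u$ is continuous on $[p_1,p_2]$, differentiable on $(p_1,p_2)$ with $\tilde u'\in L^1(p_1,p_2)$, and $\tilde u(p_1)\neq0$ if $\mu\neq1$. The function $\tilde u$ is called the regular factor of $U$. *)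

(* Defs.v *)
From HB Require Import structures.
From mathcomp Require Import all_boot all_order all_algebra.
From mathcomp Require Import complex.
From mathcomp Require Import all_classical all_reals all_analysis.

Set Implicit Arguments.
Unset Strict Implicit.
Unset Printing Implicit Defensive.

Import Order.TTheory GRing.Theory Num.Theory.
Import numFieldNormedType.Exports.

Local Open Scope classical_set_scope.
Local Open Scope ring_scope.

(* A function defined on a subset of the real line is represented by a total
   function on [R]; only its values on that subset are ever constrained or
   used. *)

Section RealFunctions.
Context {R : realType}.
Implicit Types (A I : set R) (f psi psit : R -> R).

(* Intended for open [A]: the derivatives are those of the ambient line. *)
Fixpoint Ck_on (k : nat) A f : Prop :=
  match k with
  | 0 => {within A, continuous f}
  | k'.+1 => (forall x, A x -> derivable f x 1) /\ Ck_on k' A f^`()%classic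
  end.

Definition monotone_on A f : Prop :=
  {in A &, {homo f : x y / x <= y}} \/ {in A &, {homo f : x y /~ x <= y}}.

(* Only [`|psit|] is required to be continuous: [psit] may change sign at
   [p0]. *)
Definition assumption_P I (p0 rho : R) psi psit : Prop :=
  [/\ Ck_on 1 I psi,
      Ck_on 2 (I `\ p0) psi,
      forall p, I p -> psi^`()%classic p = `|p - p0| `^ (rho - 1) * psit p,
      {within I, continuous (fun p => `|psit p|)} &
      forall p, I p -> psit p != 0].

(* The minimum, whenever it is attained: e.g. [A] compact nonempty and [f]
   continuous on [A]. *)
Definition min_on A f : R := inf (f @` A).

End RealFunctions.

(* [R[i]], packaged so that it carries the topology and norm that every
   [numClosedFieldType] has. *)
Definition Cplx (R : realType) : numClosedFieldType := R[i].

Section ComplexFunctions.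
Context {R : realType}.
Local Notation C := (Cplx R).
Implicit Types (f u U : R -> C) (A : set R).

(* [R[i]] is a normed module over itself only, so the library's [derive] does
   not apply to functions from [R] to [R[i]]: we take the limit of the
   difference quotient in the topology of [R[i]]. *)
Definition cdiffquot f (x h : R) : C := (h%:C)%C^-1 * (f (x + h) - f x).

Definition cderivable f (x : R) : Prop := cvg (cdiffquot f x @ (0 : R)^').

Definition cderive f (x : R) : C := lim (cdiffquot f x @ (0 : R)^').

Definition cintegrable A f : Prop :=
  lebesgue_measure.-integrable A (EFin \o (fun x => complex.Re (f x))) /\
  lebesgue_measure.-integrable A (EFin \o (fun x => complex.Im (f x))).

Definition cintegral A f : C :=
  ((\int[lebesgue_measure]_(x in A) complex.Re (f x)) +i*
   (\int[lebesgue_measure]_(x in A) complex.Im (f x)))%C.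

Definition cmod (z : C) : R := ComplexField.Normc.normc z.

(* L^p(A) norm, as the L^p(R) norm of the extension by zero; [fine] returns 0
   when the norm is infinite. *)
Definition cLnorm A (p : \bar R) f : R :=
  fine ('N[lebesgue_measure]_p[(EFin \o (fun x => cmod (f x))) \_ A])%E.

Definition expi (t : R) : C := (cos t +i* sin t)%C.

Definition assumption_A (p1 p2 mu : R) U u : Prop :=
  [/\ forall p, p1 < p <= p2 -> U p = (((p - p1) `^ (mu - 1))%:C)%C * u p,
      {within `[p1, p2], continuous u},
      forall p, p1 < p < p2 -> cderivable u p,
      cintegrable `]p1, p2[ (cderive u) &
      mu != 1 -> u p1 != 0].

End ComplexFunctions.

(* Main.v *)
Require Import Defs.
From mathcomp Require Import all_boot all_order all_algebra.
From mathcomp Require Import complex.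
From mathcomp Require Import all_classical all_reals all_analysis.
From mathcomp Require Import measurable_realfun ess_sup_inf.
From mathcomp Require Import ring lra.
Import Order.TTheory GRing.Theory Num.Theory.
Import numFieldNormedType.Exports.
Local Open Scope classical_set_scope.
Local Open Scope ring_scope.

(** The proof is a van der Corput estimate at the scale
    delta = omega^(-1/rho), for which omega * delta^rho = 1.

    On the part of [p1, p2] at distance at most delta from p1 or from p0 the
    integral is bounded without using any oscillation: |U| is at most
    M (p - p1)^(mu - 1) with M = ||u||_oo, and a subinterval of length L has
    mass at most L^mu / mu for the weight (p - p1)^(mu - 1), because t^mu is
    subadditive ([singular_piece]).  The lengths delta and 2 delta give
    together at most 3 M delta^mu / mu, as 2^mu <= 2.

    What remains is at most two intervals, one on each side of p0, where
    p - p1 >= delta and |p - p0| >= delta, so that the phase derivative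
    omega psi' has modulus at least omega m delta^(rho - 1), with m the minimum
    of the non-vanishing factor.  There one integrates by parts
    ([oscillatory_piece]).  The boundary terms cost 2M, the variation of the
    weight costs M, the variation of 1/psi' costs M since psi' is monotone and
    of constant sign, and the variation of u costs at most ||u'||_1, all in
    units of delta^mu / m.  Two intervals give (8M + 2||u'||_1) delta^mu / m.

    The function u' is only assumed to exist everywhere and to be integrable,
    so integration by parts is not available in its usual form.  It is replaced
    by a mean value inequality ([le_Rintegral_derive]): if f' <= k at every
    point and k is integrable, then f(b) - f(a) is at most the integral of k.
    This is applied to f = - V - A, where V' contains the integrand and A is an
    explicit function whose derivative dominates the error terms coming from
    the weight and from 1/psi'; these derivatives thus never need to be
    integrated.  The inequality holds because the points where the primitive of
    k fails to have derivative k form a null set, on which a small increasing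
    function with infinite slope ([negligible_steep_majorant]) takes over.

    Everything is done for real integrands: a complex number z has modulus at
    most B as soon as c Re z + s Im z <= B for all unit vectors (c, s)
    ([cmod_le_rotation]), which for the integral amounts to multiplying U by a
    constant of modulus one and taking the real part. *)

(** * A mean value inequality for everywhere differentiable functions *)

Section MeanValue.
Context {R : realType}.
Implicit Types (f G H k : R -> R) (a b x y e : R).
Local Notation mu := (@lebesgue_measure R).

Lemma within_itv_dist_lt f a b x e : {within `[a, b], continuous f} ->
  a <= x <= b -> 0 < e ->
  exists2 d, 0 < d & forall y, a <= y <= b -> `|y - x| < d -> `|f y - f x| < e.
Proof.
move=> /subspace_continuousP cf axb e0.
have /cvgrPdist_lt/(_ e e0) := cf x axb.
rewrite near_withinE near_nbhs/= => -[d /= d0 fd]; exists d => // y ayb yx.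
by rewrite distrC; apply: fd => //; rewrite /= distrC.
Qed.

(** Real induction from an interior point c: the supremum s of the points of
    [c, b] where H + G is at least its value at c is itself such a point,
    because H is continuous and G can only jump upwards, and the local
    hypothesis at s then forces s = b.  The inequality at a follows by letting
    c tend to a. *)
Lemma le_of_right_nondecreasing H G a b : a <= b ->
  {within `[a, b], continuous H} ->
  {homo G : x y / x <= y} ->
  (forall x, a < x < b -> \forall y \near x^'+, H x + G x <= H y + G y) ->
  H a + G a <= H b + G b.
Proof.
rewrite le_eqVlt => /predU1P[->//|ab] cH nG step.
have key c : a < c < b -> H c + G c <= H b + G b.
  move=> /andP[ac cb]; set v := H c + G c.
  pose S := [set y | c <= y <= b /\ v <= H y + G y].
  have Sc : S c by split=> //; rewrite lexx ltW.
  have supS : has_sup S by split; [exists c|exists b => y [/andP[]]].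
  have cs : c <= sup S by exact: sup_upper_bound.
  have sb : sup S <= b by apply: sup_le_ub; [exists c|move=> y [/andP[]]].
  have asb : a <= sup S <= b by rewrite sb (le_trans _ cs)// ltW.
  have vs : v <= H (sup S) + G (sup S).
    rewrite leNgt; apply/negP => sv.
    have e0 : 0 < v - (H (sup S) + G (sup S)) by rewrite subr_gt0.
    have [d d0 Hd] := within_itv_dist_lt _ _ _ _ _ cH asb e0.
    have [y [/andP[cy yb] vy] dy] := sup_adherent d0 supS.
    have ys : y <= sup S by apply: sup_upper_bound => //; split => //; rewrite cy.
    have ayb : a <= y <= b by rewrite yb (le_trans (ltW ac)).
    have {Hd} := Hd y ayb.
    rewrite distrC ger0_norm ?subr_ge0// ltrBlDr -ltrBlDl => /(_ dy).
    rewrite ltr_norml => /andP[_].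
    by have := nG _ _ ys; lra.
  move: sb; rewrite le_eqVlt => /predU1P[<-//|sb].
  have step_s : \forall y \near (sup S)^'+, H (sup S) + G (sup S) <= H y + G y.
    by apply: step; rewrite sb (lt_le_trans ac).
  have : \forall y \near (sup S)^'+,
      [/\ sup S < y, y <= b & H (sup S) + G (sup S) <= H y + G y].
    near=> y; split; near: y => //; first exact: nbhs_right_gt.
    exact: nbhs_right_ltW.
  move=> /filter_ex [y [sy yb sHG]].
  have : y <= sup S.
    apply: sup_upper_bound => //; split; first by rewrite yb (le_trans cs) ?ltW.
    exact: le_trans vs sHG.
  by rewrite leNgt sy.
apply/ler_addgt0Pr => e e0.
have aab : a <= a <= b by rewrite lexx ltW.
have [d d0 Hd] := within_itv_dist_lt _ _ _ _ _ cH aab e0.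
pose c := a + Num.min (d / 2) ((b - a) / 2).
have m0 : 0 < Num.min (d / 2) ((b - a) / 2).
  by rewrite lt_min !divr_gt0 ?subr_gt0.
have md : Num.min (d / 2) ((b - a) / 2) < d.
  by rewrite gt_min; apply/orP; left; lra.
have mb : Num.min (d / 2) ((b - a) / 2) < b - a.
  by rewrite gt_min; apply/orP; right; lra.
have ac : a < c by rewrite /c; lra.
have cb : c < b by rewrite /c; lra.
have acb : a <= c <= b by rewrite !ltW.
have {Hd} := Hd c acb.
rewrite {1}/c addrAC subrr add0r gtr0_norm// => /(_ md).
rewrite ltr_norml => /andP[He _].
have Kc : H c + G c <= H b + G b by apply: key; rewrite ac cb.
have Gac := nG _ _ (ltW ac).
lra.
Unshelve. all: by end_near. Qed.

(** Cover N by open sets V_n of measure at most e / 2^(n+1) and let G x be the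
    sum of the measures of the V_n cut at x.  A point of N has a neighbourhood
    inside the first k of the V_n, for any k, so G has slope at least k
    there. *)
Lemma negligible_steep_majorant (N : set R) e : mu.-negligible N -> 0 < e ->
  exists G : R -> R, [/\ {homo G : x y / x <= y}, forall x, 0 <= G x <= e &
    forall x c, N x -> \forall y \near x^'+, c * (y - x) <= G y - G x].
Proof.
move=> [N' [mN' N'0 NN']] e0.
have He n : 0 < e / (2 ^ n.+1)%:R.
  by rewrite divr_gt0// ltr0n expn_gt0.
have /choice[V HV] : forall n : nat, exists U : set R,
    [/\ open U, N' `<=` U & (mu (U `\` N') < (e / (2 ^ n.+1)%:R)%:E)%E].
  move=> n; apply: lebesgue_regularity_outer => //.
  by move: N'0; rewrite /= => ->; rewrite ltry.
have oV n : open (V n) by have [] := HV n.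
have NV n : N `<=` V n by have [_ + _] := HV n; exact: subset_trans.
have mV n : measurable (V n) by exact: measurable_realfun.open_measurable.
have muV n (A : set R) : measurable A ->
    (mu (V n `&` A) <= (e / (2 ^ n.+1)%:R)%:E)%E.
  move=> mA; apply: (@le_trans _ _ (mu (V n))).
    have mVA : measurable (V n `&` A) by exact: measurableI.
    by apply: le_measure; rewrite ?inE; [exact: mVA|exact: mV|exact: subIsetl].
  have [_ NV' /ltW] := HV n; apply: le_trans.
  rewrite -[X in (mu X <= _)%E](setDUK NV').
  have mVN : measurable (V n `\` N') by exact: measurableD.
  apply: (le_trans (measureU2 _ mN' mVN)).
  by rewrite [X in (X + _)%E]N'0 add0e.
pose T (A : set R) : \bar R := (\sum_(n <oo) mu (V n `&` A))%E.
have T0 A : (0 <= T A)%E by exact: nneseries_ge0.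
have Te (A : set R) : measurable A -> (T A <= e%:E)%E.
  move=> mA; apply: le_trans (epsilon_trick0 xpredT (ltW e0)).
  by apply: lee_nneseries => // n _; exact: muV.
have Tfin A : measurable A -> T A \is a fin_num.
  by move=> mA; rewrite ge0_fin_numE// (le_lt_trans (Te _ mA)) ?ltry.
have TU x y : x <= y -> T `]-oo, y]%classic =
    (T `]-oo, x]%classic + T `]x, y]%classic)%E.
  move=> xy; rewrite -nneseriesD//; apply: eq_eseriesr => n _.
  rewrite (@itv_bndbnd_setU _ _ -oo%O (BRight x))// setIUr.
  have mI1 : measurable (V n `&` `]-oo, x]) by exact: measurableI.
  have mI2 : measurable (V n `&` `]x, y]) by exact: measurableI.
  rewrite measureU//.
  rewrite -subset0 => z [[_ zx] [_ /=]]; rewrite in_itv/= ltNge.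
  by move: zx; rewrite /= in_itv/= => ->.
exists (fun x => fine (T `]-oo, x]%classic)); split => [x y xy|x|x c Nx].
- by rewrite (TU _ _ xy) fineD ?Tfin// lerDl fine_ge0.
- by rewrite fine_ge0//= -lee_fin fineK ?Tfin// Te.
(* The first m1 sets V_i already give slope m1 >= c. *)
pose m := Num.truncn `|c|; pose m1 := m.+1.
have cm : c <= m1%:R by rewrite (le_trans (ler_norm c))// ltW// truncnS_gt.
have nV : \forall y \near x, forall i : 'I_m1, V i y.
  apply: (@filter_forall _ _ (fun i : 'I_m1 => V i) (nbhs x)) => i.
  by apply: open_nbhs_nbhs; split=> //; exact: NV.
have [d /= d0 Hd] := nV.
near=> y.
have xy : x < y by near: y; exact: nbhs_right_gt.
rewrite (TU x y (ltW xy)) fineD ?Tfin// addrAC subrr add0r.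
rewrite -lee_fin fineK ?Tfin//.
apply: (@le_trans _ _ (\sum_(0 <= n < m1) mu (V n `&` `]x, y]))%E); last first.
  exact: nneseries_lim_ge.
rewrite (@eq_big_nat _ _ _ _ _ _ (fun=> (y - x)%:E)); last first.
  move=> i /andP[_ im]; rewrite setIidr.
    by rewrite lebesgue_measure_itv/= lte_fin xy EFinD.
  move=> z /=; rewrite in_itv/= => /andP[xz zy].
  apply: (Hd z _ (Ordinal im)) => /=.
  rewrite distrC ger0_norm ?subr_ge0 ?(ltW xz)//.
  rewrite (le_lt_trans (lerB zy (lexx x)))//.
  by near: y; exact: nbhs_right_ltDr.
rewrite sumEFin lee_fin sumr_const_nat subn0 -mulr_natl.
by rewrite ler_wpM2r// subr_ge0 ltW.
Unshelve. all: by end_near. Qed.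

Lemma is_derive_lt_near_right f x l c : is_derive x 1 f l -> l < c ->
  \forall y \near x^'+, f y - f x <= c * (y - x).
Proof.
move=> df lc.
have /cvg_dnbhs_at_right /cvgr_lt/(_ c) :
    (fun h : R => h^-1 * (f (h + x) - f x)) @ 0^' --> l.
  have <- : 'D_1 f x = l by exact: derive_val.
  have : derivable f x 1 by exact: ex_derive.
  rewrite /derivable /derive => /cvg_ex[m Hm].
  rewrite (cvg_lim _ Hm)//; apply: cvg_trans Hm; apply: near_eq_cvg.
  by near=> h; rewrite /= [_%:A]mulr1.
move=> /(_ lc); rewrite /at_right !near_withinE !near_nbhs => -[d /= d0 Hd].
exists d => // y /= yx xy.
have yx0 : 0 < y - x by rewrite subr_gt0.
have := Hd (y - x); rewrite /= sub0r normrN distrC subrK => /(_ yx yx0)/ltW.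
by rewrite mulrC ler_pdivrMr.
Unshelve. all: by end_near. Qed.

Lemma is_derive_gt_near_right f x l c : is_derive x 1 f l -> c < l ->
  \forall y \near x^'+, c * (y - x) <= f y - f x.
Proof.
move=> df cl; have /is_derive_lt_near_right : is_derive x 1 (- f) (- l).
  exact: is_deriveN.
move=> /(_ (- c)); rewrite ltrN2 => /(_ cl); apply: filterS => y.
by rewrite /= mulNr -opprD lerN2.
Qed.

(** Let F be a primitive of k.  At almost every x one has F' = k >= f', so
    F + e x - f increases to the right of x; at the exceptional points a steep
    majorant G does the job, since F is nondecreasing.  Hence F + G + e x - f
    satisfies the local hypothesis of [le_of_right_nondecreasing] everywhere,
    and G and e are arbitrarily small. *)
Lemma le_ge0_Rintegral_derive f f' k a b : a <= b ->
  {within `[a, b], continuous f} ->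
  (forall x, a < x < b -> is_derive x 1 f (f' x)) ->
  mu.-integrable `]a, b[ (EFin \o k) ->
  (forall x, a < x < b -> 0 <= k x) ->
  (forall x, a < x < b -> f' x <= k x) ->
  f b - f a <= \int[mu]_(x in `]a, b[) k x.
Proof.
move=> ab cf df ik k0 f'k.
pose kk := k \_ `]a, b[.
have kk0 x : 0 <= kk x.
  by rewrite /kk patchE; case: ifPn => //; rewrite inE/= in_itv/=; exact: k0.
have ikk : mu.-integrable setT (EFin \o kk).
  by move: ik; rewrite integrable_mkcond//= restrict_EFin.
pose F x := (\int[mu]_(t in `]-oo, x]) kk t)%R.
have ikkS (A : set R) : measurable A -> mu.-integrable A (EFin \o kk).
  by move=> mA; exact: integrableS ikk.
have lkk : locally_integrable [set: R] kk by exact: integrable_locally.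
have F0 x : 0 <= F x by apply: Rintegral_ge0 => t _; exact: kk0.
have FS (A B : set R) : measurable A -> measurable B -> A `<=` B ->
    \int[mu]_(t in A) kk t <= \int[mu]_(t in B) kk t.
  move=> mA mB AB; rewrite fine_le ?integrable_fin_num//; try exact: ikkS.
  apply: ge0_subset_integral => //; last by move=> x _; rewrite lee_fin.
  by have /integrableP[] := ikkS _ mB.
have nF : {homo F : x y / x <= y}.
  by move=> x y xy; apply: FS => // z /=; rewrite !in_itv/= => /le_trans; apply.
have Fb x : F x <= \int[mu]_(x in `]a, b[) k x.
  by rewrite [leRHS]Rintegral_mkcond; exact: FS.
apply/ler_addgt0Pr => e e0.
(* The slope e' over [a, b] and the majorant bounded by e' cost together
   e' (b - a) + e' = e. *)
pose e' := e / (b - a + 1).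
have ba1 : 0 < b - a + 1 by rewrite ltr_wpDl ?subr_ge0.
have e'0 : 0 < e' by rewrite divr_gt0.
have := FTC1Ny (fun y => ikkS `]-oo, y]%classic (measurable_itv _)) lkk.
move=> /(@negligible_steep_majorant _ e')/(_ e'0)[G [nG G0 HG]].
have : e' * a - f a + (F a + G a) <= e' * b - f b + (F b + G b).
  apply: (le_of_right_nondecreasing (fun x => e' * x - f x)
    (fun x => F x + G x)) => //.
  - move=> x; apply: (@continuousB R R (subspace `[a, b]) (fun x => e' * x) f x).
      by apply: continuous_subspaceT => z; exact: mulrl_continuous.
    exact: cf.
  - by move=> x y xy; rewrite lerD ?nF ?nG.
  - move=> x axb; have dfx := df _ axb.
    have [[dF F'x]|Nx] := pselect (derivable F x 1 /\ F^`()%classic x = kk x).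
      have kkx : kk x = k x by rewrite /kk patchE mem_set//= in_itv.
      have dFx : is_derive x 1 F (k x).
        by apply: DeriveDef => //; rewrite -derive1E F'x.
      near=> y.
      have xy : x <= y by near: y; exact: nbhs_right_ge.
      have fxy : f y - f x <= (f' x + e' / 2) * (y - x).
        near: y; apply: is_derive_lt_near_right dfx _.
        by rewrite ltrDl divr_gt0.
      have Fxy : (k x - e' / 2) * (y - x) <= F y - F x.
        near: y; apply: is_derive_gt_near_right dFx _.
        by rewrite ltrBlDr ltrDl divr_gt0.
      have := nG _ _ xy; have := f'k _ axb; nra.
    have HGx : \forall y \near x^'+, (f' x + 1) * (y - x) <= G y - G x.
      by apply: HG; exact: Nx.
    near=> y.
    have xy : x <= y by near: y; exact: nbhs_right_ge.
    have fxy : f y - f x <= (f' x + 1) * (y - x).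
      by near: y; apply: is_derive_lt_near_right dfx _; rewrite ltrDl.
    have Gxy : (f' x + 1) * (y - x) <= G y - G x by near: y.
    have := nF _ _ xy; nra.
have := F0 a; have := Fb b; have := G0 a; have := G0 b.
have -> : e = e' * (b - a + 1) by rewrite /e' divfK ?gt_eqF.
nra.
Unshelve. all: by end_near. Qed.

(** Adding the linear function K x to f reduces this to an integrand k + K that
    is nonnegative. *)
Lemma le_Rintegral_derive f f' k a b K : a <= b ->
  {within `[a, b], continuous f} ->
  (forall x, a < x < b -> is_derive x 1 f (f' x)) ->
  mu.-integrable `]a, b[ (EFin \o k) ->
  (forall x, a < x < b -> - K <= k x) ->
  (forall x, a < x < b -> f' x <= k x) ->
  f b - f a <= \int[mu]_(x in `]a, b[) k x.
Proof.
move=> ab cf df ik kK f'k.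
have muab : mu `]a, b[ = (b - a)%:E.
  by rewrite lebesgue_measure_itv/= lte_fin; case: ltgtP ab => // ->; rewrite subrr.
have iK : mu.-integrable `]a, b[ (EFin \o cst K).
  apply/integrableP; split; first exact/measurable_EFinP/measurable_cst.
  rewrite /= integral_cst//=; rewrite [mu _]muab -EFinM ltry//.
have := @le_ge0_Rintegral_derive (fun x => K * x + f x) (fun x => K + f' x)
  (fun x => K + k x) a b ab.
rewrite RintegralD//= Rintegral_cst//=; rewrite [mu _]muab/=.
move=> H; have : K * b + f b - (K * a + f a) <=
    K * (b - a) + \int[mu]_(x in `]a, b[) k x; last by lra.
apply: H.
- move=> x; apply: (@continuousD R R (subspace `[a, b]) (fun x => K * x) f x).
    by apply: continuous_subspaceT => z; exact: mulrl_continuous.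
  exact: cf.
- move=> x axb; have dfx := df _ axb.
  have : is_derive x 1 (K \*: id + f) (K *: 1 + f' x) by typeclasses eauto.
  by rewrite [K *: 1]mulr1.
- rewrite [X in mu.-integrable _ X](_ : _ = (EFin \o cst K) \+ (EFin \o k))%E//.
  exact: integrableD.
- by move=> x /kK; lra.
- by move=> x /f'k; lra.
Qed.

End MeanValue.

(** * The weight (x - p)^(mu - 1) *)

Section PowerWeight.
Context {R : realType}.
Implicit Types (mu a c d x y p : R).
Local Notation leb := (@lebesgue_measure R).

(** Subadditivity of t^mu: for 0 <= z <= x one has z/x <= (z/x)^mu, and the two
    instances z = y and z = x - y add up to 1. *)
Lemma powR_sub_le mu x y : 0 < mu <= 1 -> 0 <= y <= x ->
  x `^ mu - y `^ mu <= (x - y) `^ mu.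
Proof.
move=> /andP[mu0 mu1] /andP[y0 yx].
have [x0|x0] := leP x 0.
  have -> : x = 0 by lra.
  have -> : y = 0 by lra.
  by rewrite !subr0 powR0 ?gt_eqF// subr0.
have scale z : 0 <= z <= x -> x `^ mu * (z / x) <= z `^ mu.
  move=> /andP[z0 zx]; have [->|zn0] := eqVneq z 0.
    by rewrite mul0r mulr0 powR_ge0.
  have zx01 : 0 < z / x <= 1.
    by apply/andP; split; rewrite ?ler_pdivrMr ?mul1r// divr_gt0// lt_def zn0.
  rewrite -[in leRHS](divfK (lt0r_neq0 x0) z) mulrC.
  have zx0 : 0 <= z / x by case/andP: zx01 => /ltW.
  rewrite (powRM _ zx0 (ltW x0)) ler_wpM2r ?powR_ge0//.
  by rewrite -[leLHS]powRr1//; exact: ger_powR.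
have := scale y; rewrite y0 yx => /(_ isT) Hy.
have := scale (x - y); rewrite subr_ge0 yx lerBlDr lerDl y0 => /(_ isT) Hxy.
rewrite lerBlDr; apply: le_trans (lerD Hxy Hy).
by rewrite -mulrDr -mulrDl subrK divff ?lt0r_neq0// mulr1.
Qed.

Lemma is_derive_power_shift s p x : p < x ->
  is_derive x 1 (fun x => (x - p) `^ s) (s * (x - p) `^ (s - 1)).
Proof.
move=> px; have xp0 : 0 < x - p by rewrite subr_gt0.
have dsub : is_derive x 1 (id - cst p : R -> R) (1 - 0) by typeclasses eauto.
have dpow : is_derive ((id - cst p : R -> R) x) 1 (@powR R ^~ s)
    (s * (x - p) `^ (s - 1)) by exact: is_derive1_powR.
by have := @is_derive1_comp _ _ _ _ _ _ dpow dsub; rewrite subr0 mulr1.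
Qed.

Lemma continuous_power_shift s p x : p < x ->
  {for x, continuous (fun x => (x - p) `^ s)}.
Proof.
move=> px; apply/differentiable_continuous/derivable1_diffP.
by have := is_derive_power_shift s _ _ px => ?; exact: ex_derive.
Qed.

Lemma measurable_power_shift s p (B : set R) : measurable B ->
  measurable_fun B (fun x => (x - p) `^ s).
Proof.
move=> mB; apply: (measurableT_comp (measurable_powR s)).
by apply: measurable_funB => //; exact: measurable_cst.
Qed.

Lemma integral_power_shift mu p c d : 0 < mu -> p < c < d ->
  (\int[leb]_(x in `[c, d]) ((x - p) `^ (mu - 1))%:E =
   (((d - p) `^ mu - (c - p) `^ mu) / mu)%:E)%E.
Proof.
move=> mu0 /andP[pc cd].
have dF x : p < x -> is_derive x 1 (fun x => (x - p) `^ mu / mu)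
    ((x - p) `^ (mu - 1)).
  move=> px; have dx := is_derive_power_shift mu _ _ px.
  have : is_derive x 1 (mu^-1 \*: (fun x => (x - p) `^ mu))
      (mu^-1 *: (mu * (x - p) `^ (mu - 1))) by typeclasses eauto.
  rewrite [_ *: _]mulrA mulVf ?gt_eqF// mul1r.
  by congr is_derive; apply/funext => y; rewrite mulrC.
have cF x : p < x -> {for x, continuous (fun x => (x - p) `^ mu / mu)}.
  move=> px; apply/differentiable_continuous/derivable1_diffP.
  by have := dF _ px => ?; exact: ex_derive.
rewrite (@continuous_FTC2 _ _ (fun x => (x - p) `^ mu / mu))//.
- by rewrite -EFinB mulrBl.
- apply: continuous_in_subspaceT => x; rewrite inE/= in_itv/= => /andP[cx _].
  exact: continuous_power_shift (lt_le_trans pc cx).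
- split.
  + move=> x; rewrite in_itv/= => /andP[cx _].
    by have := dF x (lt_trans pc cx) => ?; exact: ex_derive.
  + by apply: cvg_at_right_filter; apply: cF.
  + by apply: cvg_at_left_filter; apply: cF; exact: lt_trans cd.
- move=> x; rewrite in_itv/= => /andP[cx _].
  have := dF x (lt_trans pc cx) => ?.
  by rewrite derive1E derive_val.
Qed.

(** The weight is unbounded at p, so the fundamental theorem of calculus is used
    on the intervals [c + 1/(n+1), d] and the result passed to the limit. *)
Lemma integral_power_le mu p c d : 0 < mu <= 1 -> p <= c <= d ->
  (\int[leb]_(x in `]c, d]) ((x - p) `^ (mu - 1))%:E <=
   ((d - c) `^ mu / mu)%:E)%E.
Proof.
move=> /[dup] mu01 /andP[mu0 mu1] /andP[pc cd].
pose A n : set R := `[c + n.+1%:R^-1, d]%classic.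
have nA : {homo A : n m / (n <= m)%N >-> (n <= m)%O}.
  move=> n m nm; apply/subsetPset => x; rewrite /A /= !in_itv/= => /andP[cx ->].
  rewrite andbT (le_trans _ cx)// lerD2l lef_pV2 ?posrE ?ltr0n//.
  by rewrite ler_nat.
have Acvg : (\int[leb]_(x in A i) ((x - p) `^ (mu - 1))%:E)%E @[i --> \oo]
   --> (\int[leb]_(x in `]c, d]) ((x - p) `^ (mu - 1))%:E)%E.
  rewrite (itv_open_bnd_bigcup _ d c).
  apply: ge0_nondecreasing_set_cvg_integral => //.
  - by move=> n; exact: measurable_itv.
  - by move=> n; apply/measurable_EFinP; apply: measurable_power_shift;
    exact: measurable_itv.
  - by move=> n x _; rewrite lee_fin powR_ge0.
rewrite -(cvg_lim _ Acvg)//; apply: lime_le; first by apply/cvg_ex; eexists; exact: Acvg.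
apply: nearW => n; rewrite /A; set e := c + _.
have ce : c < e by rewrite /e ltrDl invr_gt0 ltr0n.
have [de|ed] := leP d e.
  rewrite (@integral_Sset1 _ _ _ d) ?lee_fin ?divr_ge0 ?powR_ge0 ?(ltW mu0)//.
  move=> x /=; rewrite in_itv/= => /andP[ex xd]; apply/eqP; rewrite eq_le xd.
  exact: le_trans ex.
rewrite integral_power_shift//; last by rewrite ed (le_lt_trans pc).
rewrite lee_fin ler_pM2r ?invr_gt0//.
apply: le_trans (powR_sub_le _ _ _ mu01 _) _.
  by apply/andP; split; lra.
by apply: ge0_ler_powR; rewrite ?nnegrE; lra.
Qed.

Lemma integrable_power mu p d : 0 < mu <= 1 -> p <= d ->
  leb.-integrable `]p, d] (EFin \o (fun x => (x - p) `^ (mu - 1))).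
Proof.
move=> mu01 pd; apply/integrableP; split.
  by apply/measurable_EFinP; apply: measurable_power_shift;
    exact: measurable_itv.
under eq_integral do rewrite /= ger0_norm ?powR_ge0//.
by rewrite (le_lt_trans (integral_power_le _ _ _ _ mu01 _)) ?ltry// lexx.
Qed.

Lemma Rintegral_power_le mu p c d : 0 < mu <= 1 -> p <= c <= d ->
  \int[leb]_(x in `]c, d]) ((x - p) `^ (mu - 1)) <= (d - c) `^ mu / mu.
Proof.
move=> mu01 pcd; have := integral_power_le _ _ _ _ mu01 pcd.
rewrite -lee_fin /Rintegral fineK//.
rewrite ge0_fin_numE; last by apply: integral_ge0 => x _; rewrite lee_fin powR_ge0.
exact: le_lt_trans (integral_power_le _ _ _ _ mu01 pcd) (ltry _).
Qed.

End PowerWeight.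

(** * The first derivative test for oscillatory integrals *)

Section VanDerCorput.
Context {R : realType}.
Local Notation leb := (@lebesgue_measure R).
Implicit Types (a b x l M lam c s : R).

Lemma is_derive_inv (f : R -> R) x l : f x != 0 -> is_derive x 1 f l ->
  is_derive x 1 (fun y => (f y)^-1) (- l / f x ^+ 2).
Proof.
move=> fx0 df; have dv : derivable f x 1 by exact: ex_derive.
apply: DeriveDef; first exact: derivableV.
by rewrite deriveV// derive_val scaleNr [_ *: _]mulrC mulNr.
Qed.

(** Cauchy-Schwarz for the planar vectors (a, b) and (s, -c). *)
Lemma normr_le_cross a b c s M : 0 <= M -> a ^+ 2 + b ^+ 2 <= M ^+ 2 ->
  c ^+ 2 + s ^+ 2 = 1 -> `|a * s - b * c| <= M.
Proof.
move=> M0 abM cs1; rewrite -(@ler_pXn2r _ 2) ?nnegrE// real_normK ?num_real//.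
have : 0 <= (a * c + b * s) ^+ 2 by exact: sqr_ge0.
have := mulr1 (a ^+ 2 + b ^+ 2); rewrite -cs1; nra.
Qed.

Lemma continuous_nonvanishing_same_sign (f : R -> R) a b : a <= b ->
  {within `[a, b], continuous f} -> (forall x, a <= x <= b -> f x != 0) ->
  0 < f a * f b.
Proof.
move=> ab cf f0; have fa := f0 a; have fb := f0 b.
rewrite lexx ab in fa; rewrite lexx ab in fb.
have {}fa := fa isT; have {}fb := fb isT.
rewrite lt_neqAle eq_sym mulf_neq0//= leNgt; apply/negP => fafb.
have [|c] := @IVT _ f a b 0 ab cf; last first.
  by rewrite in_itv/= => /f0/eqP.
have [fa0|fa0] := ltP (f a) 0.
  have fb0 : 0 < f b by nra.
  by rewrite ge_min le_max (ltW fa0) (ltW fb0) orbT.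
have {fa0}fa0 : 0 < f a by rewrite lt_def fa.
have fb0 : f b < 0 by nra.
by rewrite ge_min le_max (ltW fa0) (ltW fb0) orbT.
Qed.

(** With S = P sin th - Q cos th, the function V = W S / th' satisfies
      V' = W (P cos th + Q sin th) + (W / th')' S
           + (W / th') (P' sin th - Q' cos th).
    The last term is at most (W a / lam) h.  In the middle one, W' / th' is
    absorbed by the monotone function - M W / lam, and W (1/th')' by
    M (W a) / th', which is nondecreasing as th'' <= 0.  Thus f = - V - A, with
    A the sum of these two functions, has f' <= (W a / lam) h - (integrand), and
    [le_Rintegral_derive] leaves only end values of V and A to bound: 2M for V,
    M for each part of A, in units of W a / lam. *)
Lemma oscillatory_piece_noninc a b (W W' P P' Q Q' th th' th'' h : R -> R) M lam :
  a < b -> 0 < lam -> 0 <= M ->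
  {within `[a, b], continuous W} ->
  {within `[a, b], continuous P} ->
  {within `[a, b], continuous Q} ->
  {within `[a, b], continuous th} ->
  {within `[a, b], continuous th'} ->
  (forall x, a < x < b -> is_derive x 1 W (W' x)) ->
  (forall x, a < x < b -> is_derive x 1 P (P' x)) ->
  (forall x, a < x < b -> is_derive x 1 Q (Q' x)) ->
  (forall x, a < x < b -> is_derive x 1 th (th' x)) ->
  (forall x, a < x < b -> is_derive x 1 th' (th'' x)) ->
  (forall x, a <= x <= b -> 0 <= W x <= W a) ->
  (forall x, a < x < b -> W' x <= 0) ->
  (forall x, a <= x <= b -> P x ^+ 2 + Q x ^+ 2 <= M ^+ 2) ->
  leb.-integrable `]a, b[ (EFin \o h) ->
  (forall x, a < x < b -> 0 <= h x) ->
  (forall x, a < x < b -> P' x ^+ 2 + Q' x ^+ 2 <= h x ^+ 2) ->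
  (forall x, a <= x <= b -> lam <= `|th' x|) ->
  (forall x, a < x < b -> th'' x <= 0) ->
  \int[leb]_(x in `]a, b]) (W x * (P x * cos (th x) + Q x * sin (th x))) <=
    W a / lam * (4 * M + \int[leb]_(x in `]a, b[) h x).
Proof.
move=> ab lam0 M0 cW cP cQ cth cth' dW dP dQ dth dth' W0 W'0 PQM ih h0 P'Q'h.
move=> lamth' th''0.
have ooW x : a < x < b -> a <= x <= b by move=> /andP[/ltW -> /ltW ->].
have th'0 x : a <= x <= b -> th' x != 0.
  by move=> /lamth'; apply: contraTneq => ->; rewrite normr0 -ltNge.
pose C x := P x * cos (th x) + Q x * sin (th x).
pose S : R -> R := P * (sin \o th) - Q * (cos \o th).
pose r x := (th' x)^-1.
pose r' x := - th'' x / th' x ^+ 2.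
pose D x := P' x * sin (th x) - Q' x * cos (th x).
have SM x : a <= x <= b -> `|S x| <= M.
  by move=> axb; exact: (normr_le_cross _ _ _ _ _ M0 (PQM _ axb) (cos2Dsin2 _)).
have CM x : a <= x <= b -> `|C x| <= M.
  move=> /PQM H.
  have := @normr_le_cross (P x) (Q x) (- sin (th x)) (cos (th x)) M M0 H.
  by rewrite sqrrN addrC cos2Dsin2 mulrN opprK; exact.
have Dh x : a < x < b -> `|D x| <= h x.
  move=> axb.
  exact: (normr_le_cross _ _ _ _ _ (h0 _ axb) (P'Q'h _ axb) (cos2Dsin2 _)).
have rlam x : a <= x <= b -> `|r x| <= lam^-1.
  by move=> axb; rewrite normfV lef_pV2 ?posrE ?normr_gt0 ?th'0 ?lamth'.
have r'0 x : a < x < b -> 0 <= r' x.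
  by move=> axb; rewrite divr_ge0 ?sqr_ge0// oppr_ge0 th''0.
have dr x : a < x < b -> is_derive x 1 r (r' x).
  by move=> axb; apply: is_derive_inv; [exact/th'0/ooW|exact: dth'].
(* f = - V - A in the notation above. *)
pose f : R -> R := - (W * r * S) + (M / lam) \*: W - (M * W a) \*: r.
pose f' x := - (W' x * r x * S x + W x * r' x * S x + W x * C x + W x * r x * D x)
  + M / lam * W' x - M * W a * r' x.
have df x : a < x < b -> is_derive x 1 f (f' x).
  move=> axb.
  have dWx := dW _ axb; have dPx := dP _ axb; have dQx := dQ _ axb.
  have dthx := dth _ axb; have drx := dr _ axb.
  apply: is_derive_eq; rewrite /f' /C /D /S /=.
  have rth : r x * th' x = 1 by rewrite mulVf// th'0// ooW.
  apply/eqP; rewrite -subr_eq0; apply/eqP.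
  rewrite !fctE /GRing.scale/= [LHS](_ : _ = W x * C x * (1 - r x * th' x)).
    by rewrite rth subrr mulr0.
  by rewrite /C; ring.
pose k x := W a / lam * h x - W x * C x.
have cin (g : R -> R) : {within `[a, b], continuous g} ->
    forall x, x \in `[a, b] -> g y @[y --> within `[a, b] (nbhs x)] --> g x.
  by move=> /subspace_continuousP.
have cr x : x \in `[a, b] -> r y @[y --> within `[a, b] (nbhs x)] --> r x.
  move=> xab; apply: cvgV; last exact: cin.
  by apply: th'0; move: xab; rewrite in_itv.
have csin x : x \in `[a, b] ->
    sin (th y) @[y --> within `[a, b] (nbhs x)] --> sin (th x).
  by move=> xab; apply: continuous_cvg; [exact: continuous_sin|exact: cin].
have ccos x : x \in `[a, b] ->
    cos (th y) @[y --> within `[a, b] (nbhs x)] --> cos (th x).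
  by move=> xab; apply: continuous_cvg; [exact: continuous_cos|exact: cin].
have cf : {within `[a, b], continuous f}.
  apply/subspace_continuousP => x /= xab.
  apply: cvgB; last by apply: cvgZr; exact: cr.
  apply: cvgD; last by apply: cvgZr; exact: cin.
  apply: cvgN; apply: cvgM.
    by apply: cvgM; [exact: cin|exact: cr].
  by apply: cvgB; apply: cvgM; [exact: cin|exact: csin|exact: cin|exact: ccos].
have cWC : {within `[a, b], continuous (fun x => W x * C x)}.
  apply/subspace_continuousP => x /= xab; apply: cvgM; first exact: cin.
  by apply: cvgD; apply: cvgM; [exact: cin|exact: ccos|exact: cin|exact: csin].
have iWC : leb.-integrable `[a, b] (EFin \o (fun x => W x * C x)).
  by apply: continuous_compact_integrable => //; exact: segment_compact.
have iWCo : leb.-integrable `]a, b[ (EFin \o (fun x => W x * C x)).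
  by apply: integrableS iWC => //; exact: subset_itv_oo_cc.
have ihl : leb.-integrable `]a, b[ (EFin \o (fun x => W a / lam * h x)).
  rewrite [X in leb.-integrable _ X](_ : _ =
    (fun x => (W a / lam)%:E * (EFin \o h) x)%E)//.
  exact: integrableZl.
have aab : a <= a <= b by rewrite lexx ltW.
have bab : a <= b <= b by rewrite lexx ltW.
have Wa0 : 0 <= W a by have /andP[] := W0 _ aab.
have ik : leb.-integrable `]a, b[ (EFin \o k).
  rewrite [X in leb.-integrable _ X](_ : _ =
    (EFin \o (fun x => W a / lam * h x)%R) \- (EFin \o (fun x => W x * C x)%R))%E//.
  exact: integrableB.
have H := @le_Rintegral_derive R f f' k a b (W a * M) (ltW ab) cf df ik _ _.
have {H} : f b - f a <= \int[leb]_(x in `]a, b[) k x.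
  apply: H => x axb; have xab := ooW _ axb.
    rewrite /k; have := CM _ xab; have := h0 _ axb; have := W0 _ xab.
    rewrite ler_norml => /andP[Wx0 WxWa] hx0 /andP[_ CM1].
    have : 0 <= W a / lam * h x by rewrite mulr_ge0 ?divr_ge0 ?(ltW lam0).
    nra.
  have /andP[Wx0 WxWa] := W0 _ xab.
  have rS : `|r x * S x| <= lam^-1 * M.
    by rewrite normrM ler_pM ?rlam ?SM.
  have rD : `|r x * D x| <= lam^-1 * h x.
    by rewrite normrM ler_pM ?rlam ?Dh.
  have /andP[_ rS1] : - (lam^-1 * M) <= r x * S x <= lam^-1 * M by rewrite -ler_norml.
  have /andP[rD0 _] : - (lam^-1 * h x) <= r x * D x <= lam^-1 * h x.
    by rewrite -ler_norml.
  have /andP[S0 _] : - M <= S x <= M by rewrite -ler_norml SM.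
  have r'x := r'0 _ axb.
  have lV : 0 <= lam^-1 by rewrite invr_ge0 ltW.
  have e1 : 0 <= - W' x * (lam^-1 * M - r x * S x).
    by rewrite mulr_ge0 ?oppr_ge0 ?W'0// subr_ge0.
  have e2 : 0 <= W x * r' x * (M + S x).
    by apply: mulr_ge0; [exact: mulr_ge0|rewrite -lerBlDl sub0r].
  have e3 : 0 <= (W a - W x) * r' x * M.
    by apply: mulr_ge0 => //; apply: mulr_ge0 => //; rewrite subr_ge0.
  have e4 : 0 <= W x * (lam^-1 * h x + r x * D x).
    by apply: mulr_ge0 => //; rewrite -lerBlDl sub0r.
  have e5 : 0 <= (W a - W x) * (lam^-1 * h x).
    by apply: mulr_ge0; rewrite ?subr_ge0// mulr_ge0// h0.
  rewrite /f' /k; lra.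
rewrite /k RintegralB//= RintegralZl//= (Rintegral_itv_bndo_bndc iWCo).
set I := Rintegral _ _ _; set H := Rintegral _ _ _ => fI.
suff : f a - f b <= 4 * M * (W a / lam) by move: fI; rewrite /I /H; lra.
have lV : 0 <= lam^-1 by rewrite invr_ge0 ltW.
have /andP[Wb0 WbWa] := W0 _ bab.
have rSa : `|r a * S a| <= lam^-1 * M by rewrite normrM ler_pM ?rlam ?SM.
have rSb : `|r b * S b| <= lam^-1 * M by rewrite normrM ler_pM ?rlam ?SM.
have /andP[rSa0 _] : - (lam^-1 * M) <= r a * S a <= lam^-1 * M by rewrite -ler_norml.
have /andP[_ rSb1] : - (lam^-1 * M) <= r b * S b <= lam^-1 * M by rewrite -ler_norml.
(* both end values of 1/th' have the sign of th', so they differ by at most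
   the larger modulus *)
have rba : r b - r a <= lam^-1.
  have := continuous_nonvanishing_same_sign _ _ _ (ltW ab) cth' th'0.
  have := rlam _ aab; have := rlam _ bab; rewrite !ler_norml.
  move=> /andP[rb1 rb2] /andP[ra1 ra2] ss.
  have [th'a|th'a] := ltP 0 (th' a).
    have : 0 <= r a by rewrite invr_ge0 ltW.
    lra.
  have th'b : th' b < 0 by nra.
  have : r b <= 0 by rewrite invr_le0 ltW.
  lra.
have e1 : 0 <= W a * (lam^-1 * M + r a * S a).
  by rewrite mulr_ge0// -lerBlDl sub0r.
have e2 : 0 <= W b * (lam^-1 * M - r b * S b).
  by rewrite mulr_ge0// subr_ge0.
have e3 : 0 <= (W a - W b) * (lam^-1 * M) by rewrite !mulr_ge0// subr_ge0.
have e4 : 0 <= M * W a * (lam^-1 - (r b - r a)) by rewrite !mulr_ge0// subr_ge0.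
have e5 : 0 <= M * lam^-1 * W b by rewrite !mulr_ge0.
have fE x : f x = - (W x * r x * S x) + M / lam * W x - M * W a * r x by [].
rewrite !fE; lra.
Qed.

(** The other monotonicity of th' is obtained by changing the signs of th and
    Q, which does not change the integrand. *)
Lemma oscillatory_piece a b (W W' P P' Q Q' th th' th'' h : R -> R) M lam :
  a < b -> 0 < lam -> 0 <= M ->
  {within `[a, b], continuous W} ->
  {within `[a, b], continuous P} ->
  {within `[a, b], continuous Q} ->
  {within `[a, b], continuous th} ->
  {within `[a, b], continuous th'} ->
  (forall x, a < x < b -> is_derive x 1 W (W' x)) ->
  (forall x, a < x < b -> is_derive x 1 P (P' x)) ->
  (forall x, a < x < b -> is_derive x 1 Q (Q' x)) ->
  (forall x, a < x < b -> is_derive x 1 th (th' x)) ->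
  (forall x, a < x < b -> is_derive x 1 th' (th'' x)) ->
  (forall x, a <= x <= b -> 0 <= W x <= W a) ->
  (forall x, a < x < b -> W' x <= 0) ->
  (forall x, a <= x <= b -> P x ^+ 2 + Q x ^+ 2 <= M ^+ 2) ->
  leb.-integrable `]a, b[ (EFin \o h) ->
  (forall x, a < x < b -> 0 <= h x) ->
  (forall x, a < x < b -> P' x ^+ 2 + Q' x ^+ 2 <= h x ^+ 2) ->
  (forall x, a <= x <= b -> lam <= `|th' x|) ->
  (forall x, a < x < b -> th'' x <= 0) \/ (forall x, a < x < b -> 0 <= th'' x) ->
  \int[leb]_(x in `]a, b]) (W x * (P x * cos (th x) + Q x * sin (th x))) <=
    W a / lam * (4 * M + \int[leb]_(x in `]a, b[) h x).
Proof.
move=> ab lam0 M0 cW cP cQ cth cth' dW dP dQ dth dth' W0 W'0 PQM ih h0 P'Q'h.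
move=> lamth' [th''0|th''0].
  exact: (oscillatory_piece_noninc _ _ _ W' _ P' _ Q' _ th' th'').
have cN (g : R -> R) : {within `[a, b], continuous g} ->
    {within `[a, b], continuous (- g)}.
  by move=> cg x; apply: continuousN; exact: cg.
have -> : \int[leb]_(x in `]a, b]) (W x * (P x * cos (th x) + Q x * sin (th x))) =
    \int[leb]_(x in `]a, b]) (W x * (P x * cos ((- th) x) + (- Q) x * sin ((- th) x))).
  by apply: eq_Rintegral => x _; rewrite !fctE cosN sinN mulrNN.
apply: (oscillatory_piece_noninc _ _ _ W' _ P' _ (- Q') _ (- th') (- th'')) => //.
- exact: cN.
- exact: cN.
- exact: cN.
- by move=> x axb; apply: is_deriveN; exact: dQ.
- by move=> x axb; apply: is_deriveN; exact: dth.
- by move=> x axb; apply: is_deriveN; exact: dth'.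
- by move=> x axb; rewrite !fctE sqrrN PQM.
- by move=> x axb; rewrite !fctE sqrrN P'Q'h.
- by move=> x axb; rewrite !fctE normrN lamth'.
- by move=> x axb; rewrite !fctE oppr_le0 th''0.
Qed.

End VanDerCorput.

(** * Real and imaginary parts *)

Section ComplexToReal.
Context {R : realType}.
Local Notation leb := (@lebesgue_measure R).
Local Notation C := (Cplx R).
Implicit Types (u : R -> C) (x : R).

Lemma cmod_sqr (z : C) : cmod z ^+ 2 = complex.Re z ^+ 2 + complex.Im z ^+ 2.
Proof. by case: z => a b; rewrite /cmod /= sqr_sqrtr// addr_ge0// sqr_ge0. Qed.

Lemma cmod_ge0 (z : C) : 0 <= cmod z.
Proof. by case: z => a b; exact: sqrtr_ge0. Qed.

Lemma normr_Re_le_cmod (z : C) : `|complex.Re z| <= cmod z.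
Proof.
rewrite -(@ler_pXn2r _ 2) ?nnegrE ?cmod_ge0// cmod_sqr real_normK ?num_real//.
by rewrite lerDl sqr_ge0.
Qed.

Lemma normr_Im_le_cmod (z : C) : `|complex.Im z| <= cmod z.
Proof.
rewrite -(@ler_pXn2r _ 2) ?nnegrE ?cmod_ge0// cmod_sqr real_normK ?num_real//.
by rewrite lerDr sqr_ge0.
Qed.

Lemma near_cmod_lt {T : Type} (F : set_system T) {FF : Filter F} (f : T -> C)
  (l : C) (e : R) : f @ F --> l -> 0 < e -> \forall t \near F, cmod (l - f t) < e.
Proof.
move=> /cvgrPdist_lt fl e0.
have e0C : 0 < (e%:C)%C :> C by rewrite ltcR.
by have := fl _ e0C; apply: filterS => t; rewrite ltcR.
Qed.

Lemma cvg_Re {T : Type} (F : set_system T) {FF : Filter F} (f : T -> C) (l : C) :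
  f @ F --> l -> complex.Re (f t) @[t --> F] --> complex.Re l.
Proof.
move=> fl; apply/cvgrPdist_lt => e e0.
near=> t.
have flt : cmod (l - f t) < e by near: t; exact: near_cmod_lt.
apply: le_lt_trans flt.
by rewrite -raddfB; exact: normr_Re_le_cmod.
Unshelve. all: by end_near. Qed.

Lemma cvg_Im {T : Type} (F : set_system T) {FF : Filter F} (f : T -> C) (l : C) :
  f @ F --> l -> complex.Im (f t) @[t --> F] --> complex.Im l.
Proof.
move=> fl; apply/cvgrPdist_lt => e e0.
near=> t.
have flt : cmod (l - f t) < e by near: t; exact: near_cmod_lt.
apply: le_lt_trans flt.
by rewrite -raddfB; exact: normr_Im_le_cmod.
Unshelve. all: by end_near. Qed.

Lemma within_continuous_Re u (A : set R) : {within A, continuous u} ->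
  {within A, continuous (fun x => complex.Re (u x))}.
Proof. by move=> cu x; apply: cvg_Re; exact: cu. Qed.

Lemma within_continuous_Im u (A : set R) : {within A, continuous u} ->
  {within A, continuous (fun x => complex.Im (u x))}.
Proof. by move=> cu x; apply: cvg_Im; exact: cu. Qed.

Lemma ReImMr (r : R) (z : C) : complex.Re ((r%:C)%C * z) = r * complex.Re z /\
  complex.Im ((r%:C)%C * z) = r * complex.Im z.
Proof. by case: z => a b /=; rewrite !mul0r subr0 addr0. Qed.

Lemma cdiffquotE u x (h : R) :
  complex.Re (cdiffquot u x h) = h^-1 * (complex.Re (u (x + h)) - complex.Re (u x)) /\
  complex.Im (cdiffquot u x h) = h^-1 * (complex.Im (u (x + h)) - complex.Im (u x)).
Proof.
rewrite /cdiffquot.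
have -> : ((h%:C)%C^-1 : C) = ((h^-1)%:C)%C by rewrite fmorphV.
by have [-> ->] := ReImMr h^-1 (u (x + h) - u x); rewrite !raddfB.
Qed.

(** The increments of [cdiffquot] are written x + h, those of [derivable]
    h + x. *)
Lemma is_derive_cvg (f : R -> R) x l :
  h^-1 * (f (x + h) - f x) @[h --> 0^'] --> l -> is_derive x 1 f l.
Proof.
have E : (fun h : R => h^-1 * (f (x + h) - f x)) =
    (fun h => h^-1 *: ((f \o shift x) (h *: 1) - f x)).
  by apply/funext => h; rewrite /= [_%:A]mulr1 [h + x]addrC.
rewrite E => H; apply: DeriveDef; first by apply/cvg_ex; exists l.
exact: cvg_lim H.
Qed.

Lemma is_derive_Re u x : cderivable u x ->
  is_derive x 1 (fun y => complex.Re (u y)) (complex.Re (cderive u x)).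
Proof.
move=> du; apply: is_derive_cvg; have := cvg_Re _ _ _ du => /(_ (dnbhs_filter _)).
by apply: cvg_trans; apply: near_eq_cvg; near=> h; rewrite (cdiffquotE u x h).1.
Unshelve. all: by end_near. Qed.

Lemma is_derive_Im u x : cderivable u x ->
  is_derive x 1 (fun y => complex.Im (u y)) (complex.Im (cderive u x)).
Proof.
move=> du; apply: is_derive_cvg; have := cvg_Im _ _ _ du => /(_ (dnbhs_filter _)).
by apply: cvg_trans; apply: near_eq_cvg; near=> h; rewrite (cdiffquotE u x h).2.
Unshelve. all: by end_near. Qed.

(** Take for (c, s) the direction of z. *)
Lemma cmod_le_rotation (z : C) (B : R) :
  (forall c s, c ^+ 2 + s ^+ 2 = 1 -> c * complex.Re z + s * complex.Im z <= B) ->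
  cmod z <= B.
Proof.
move=> H; have [z0|z0] := eqVneq (cmod z) 0.
  have := H 1 0; have := H (-1) 0; rewrite !expr2; lra.
have e : (complex.Re z / cmod z) ^+ 2 + (complex.Im z / cmod z) ^+ 2 = 1.
  by rewrite !exprMn -mulrDl -cmod_sqr exprVn divff// expf_neq0.
have := H _ _ e; rewrite mulrAC [_ / _ * _]mulrAC -mulrDl -!expr2 -cmod_sqr.
by rewrite expr2 mulfK.
Qed.

End ComplexToReal.

(** * The norms of the regular factor *)

Section Norms.
Context {R : realType}.
Local Notation leb := (@lebesgue_measure R).
Local Notation C := (Cplx R).
Implicit Types (u v : R -> C) (a b x : R).

Lemma within_continuous_cmod u a b : {within `[a, b], continuous u} ->
  {within `[a, b], continuous (fun x => cmod (u x))}.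
Proof.
move=> cu; have cRe := within_continuous_Re _ _ cu.
have cIm := within_continuous_Im _ _ cu.
have -> : (fun x => cmod (u x)) =
    (fun x => Num.sqrt (complex.Re (u x) ^+ 2 + complex.Im (u x) ^+ 2)).
  by apply/funext => x; rewrite /cmod; case: (u x).
move=> x; apply: continuous_cvg; first exact: sqrt_continuous.
by apply: cvgD; [apply: (cvgM (cRe x) (cRe x))|apply: (cvgM (cIm x) (cIm x))].
Qed.

(** The essential supremum bounds |u| almost everywhere; by continuity a point
    of [a, b] violating the bound would have a whole interval of violating
    points next to it. *)
Lemma cmod_le_cLnormy u a b x : a < b -> {within `[a, b], continuous u} ->
  a <= x <= b -> cmod (u x) <= cLnorm `]a, b[ +oo%E u.
Proof.
move=> ab cu axb; have cg := within_continuous_cmod _ _ _ cu.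
set g := fun x => cmod (u x) in cg.
have [c _ gc] := EVT_max (ltW ab) cg.
pose phi := ((EFin \o g) \_ `]a, b[)%E.
have phiE y : phi y = if y \in `]a, b[ then (g y)%:E else 0%E.
  rewrite /phi patchE; congr (if _ then _ else _).
  by rewrite /in_mem/= /in_set; apply: asboolb.
have phi0 y : (0 <= phi y)%E.
  by rewrite phiE; case: ifP => // _; rewrite lee_fin cmod_ge0.
have muT : (0 < leb setT)%E.
  apply: (@lt_le_trans _ _ (leb `]a, b[)).
    by rewrite lebesgue_measure_itv/= lte_fin ab -EFinB lte_fin subr_gt0.
  by apply: le_measure; rewrite ?inE//; exact: measurable_itv.
have LE : cLnorm `]a, b[ +oo%E u = fine (ess_sup leb (abse \o phi)).
  by rewrite /cLnorm unlock muT.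
set E := ess_sup _ _ in LE.
have E0 : (0 <= E)%E.
  by apply: ess_sup_gee => //; apply: aeW => y; exact: abse_ge0.
have EK : (E <= (g c)%:E)%E.
  apply/ess_supP; apply: aeW => y /=; rewrite gee0_abs// phiE.
  case: ifPn => [yab|_]; last by rewrite lee_fin cmod_ge0.
  by rewrite lee_fin gc//; exact: subset_itv_oo_cc yab.
have Efin : E \is a fin_num by rewrite ge0_fin_numE// (le_lt_trans EK) ?ltry.
rewrite LE leNgt; apply/negP => Egx.
have e0 : 0 < g x - fine E by rewrite subr_gt0.
have [d d0 Hd] := within_itv_dist_lt _ _ _ _ _ cg axb e0.
have : \forall y \ae leb, ((abse \o phi) y <= E)%E by exact: ess_sup_ge.
move: axb => /andP[ax xb].
pose s := Num.max a (x - d); pose t := Num.min b (x + d).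
have st : s < t by rewrite /s /t gt_max !lt_min; lra.
move=> aeE.
have : leb `]s, t[ = 0%E.
  apply/negligibleP; first exact: measurable_itv.
  apply: (negligibleS _ aeE) => y /=; rewrite in_itv/= /s /t gt_max lt_min.
  move=> /andP[/andP[ay xdy] /andP[yb yxd]]; apply/negP; rewrite -ltNge.
  rewrite gee0_abs// phiE in_itv/= ay yb/= -(fineK Efin) lte_fin.
  have ayb : a <= y <= b by rewrite !ltW.
  have yx : `|y - x| < d by rewrite ltr_norml; lra.
  by have := Hd _ ayb yx; rewrite ltr_norml; lra.
rewrite lebesgue_measure_itv/= lte_fin st -EFinB => -[] /eqP.
by rewrite subr_eq0 gt_eqF.
Qed.

Lemma integrable_cmod v a b : cintegrable `]a, b[ v ->
  leb.-integrable `]a, b[ (EFin \o (fun x => cmod (v x))).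
Proof.
move=> [iRe iIm].
have mRe : measurable_fun `]a, b[ (fun x => complex.Re (v x)).
  by apply/measurable_EFinP; exact: measurable_int iRe.
have mIm : measurable_fun `]a, b[ (fun x => complex.Im (v x)).
  by apply/measurable_EFinP; exact: measurable_int iIm.
apply: (@le_integrable _ _ _ leb _ _ _
  (fun x => `|(complex.Re (v x))%:E| + `|(complex.Im (v x))%:E|)%E) => //.
- apply/measurable_EFinP.
  have -> : (fun x => cmod (v x)) =
      (fun x => Num.sqrt (complex.Re (v x) ^+ 2 + complex.Im (v x) ^+ 2)).
    by apply/funext => x; rewrite /cmod; case: (v x).
  apply: measurableT_comp.
    by apply: continuous_measurable_fun; exact: sqrt_continuous.
  by apply: measurable_funD; apply: measurable_funX.
- move=> x _ /=; rewrite !lee_fin.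
  rewrite ger0_norm ?cmod_ge0// [leRHS]ger0_norm ?addr_ge0//.
  rewrite -(@ler_pXn2r _ 2) ?nnegrE ?addr_ge0 ?cmod_ge0// cmod_sqr sqrrD.
  by rewrite !real_normK ?num_real// lerD2r lerDl mulrn_wge0// mulr_ge0.
- by apply: integrableD => //; exact: integrable_abse.
Qed.

Lemma cLnorm1E v a b : cLnorm `]a, b[ 1%E v = \int[leb]_(x in `]a, b[) cmod (v x).
Proof.
rewrite /cLnorm Lnorm1 /Rintegral [in RHS]integral_mkcond; congr fine.
apply: eq_integral => x _; rewrite !patchE; case: ifP => // _; last by rewrite abse0.
by rewrite /= ger0_norm ?cmod_ge0.
Qed.

End Norms.

(** * Estimates away from and near the singular points *)

Section Pieces.
Context {R : realType}.
Local Notation leb := (@lebesgue_measure R).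
Implicit Types (f g : R -> R) (a b c d e p x l M K mu del om rho m : R).

Lemma nondecreasing_is_derive_ge0 f x b l : x < b -> is_derive x 1 f l ->
  (forall y, x < y < b -> f x <= f y) -> 0 <= l.
Proof.
move=> xb df nf; rewrite leNgt; apply/negP => l0.
have ll2 : l < l / 2 by lra.
have near_f := is_derive_lt_near_right _ _ _ _ df ll2.
suff : \forall y \near x^'+, False by move=> /filter_ex [].
near=> y.
have xy : x < y by near: y; exact: nbhs_right_gt.
have yb : y < b by near: y; exact: nbhs_right_lt.
have fy : f y - f x <= l / 2 * (y - x) by near: y.
have := nf y; rewrite xy yb => /(_ isT) fxy.
by nra.
Unshelve. all: by end_near. Qed.

(** A monotone function has a derivative of constant sign; applied to psi', this
    is what makes the total variation of 1/psi' computable from its end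
    values. *)
Lemma monotone_is_derive_sign (A : set R) (f f' : R -> R) a b :
  monotone_on A f -> (forall x, a < x < b -> A x) ->
  (forall x, a < x < b -> is_derive x 1 f (f' x)) ->
  (forall x, a < x < b -> f' x <= 0) \/ (forall x, a < x < b -> 0 <= f' x).
Proof.
move=> mf Aab df; case: mf => mf; [right|left] => x /[dup] axb /andP[ax xb].
  apply: (nondecreasing_is_derive_ge0 _ _ _ _ xb (df _ axb)) => y /andP[xy yb].
  apply: mf; rewrite ?inE ?(ltW xy)//; apply: Aab => //.
  by rewrite yb (lt_trans ax).
have dNf : is_derive x 1 (- f) (- f' x) by apply: is_deriveN; exact: df.
rewrite -oppr_ge0; apply: (nondecreasing_is_derive_ge0 _ _ _ _ xb dNf).
move=> y /andP[xy yb]; rewrite lerN2.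
apply: mf; rewrite ?inE ?(ltW xy)//; apply: Aab => //.
by rewrite yb (lt_trans ax).
Qed.

Lemma Rintegral_itv_oc_split f c d e : c <= d <= e ->
  leb.-integrable `]c, e] (EFin \o f) ->
  \int[leb]_(x in `]c, e]) f x =
  \int[leb]_(x in `]c, d]) f x + \int[leb]_(x in `]d, e]) f x.
Proof.
move=> /andP[cd de] fi.
have := @Rintegral_itvB R f (BRight c) (BRight e) d fi.
by rewrite !bnd_simp => /(_ cd de) <-; rewrite subrKC.
Qed.

(** A continuous function is bounded on [p, d], so the product is dominated by a
    multiple of the integrable weight. *)
Lemma integrable_power_mul g mu p d : 0 < mu <= 1 -> p <= d ->
  {within `[p, d], continuous g} ->
  leb.-integrable `]p, d] (EFin \o (fun x => (x - p) `^ (mu - 1) * g x)).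
Proof.
move=> mu01 pd cg.
have cng : {within `[p, d], continuous (fun x => `|g x|)}.
  by move=> x; apply: cvg_norm; exact: cg.
have [c _ gc] := EVT_max pd cng.
have mg : measurable_fun `]p, d] g.
  apply: (@measurable_funS _ _ _ _ `[p, d]%classic) => //.
    exact: subset_itv_oc_cc.
  by apply: subspace_continuous_measurable_fun.
have iw := integrable_power _ _ _ mu01 pd.
apply: (@le_integrable _ _ _ leb _ _ _
  (fun x => (`|g c|)%:E * (EFin \o (fun x => (x - p) `^ (mu - 1))%R) x)%E) => //.
- apply/measurable_EFinP; apply: measurable_funM => //.
  by apply: measurable_power_shift;
    exact: measurable_itv.
- move=> x xpd; rewrite /= lee_fin !normrM normr_id mulrC ler_wpM2r//.
  by apply: gc; exact: subset_itv_oc_cc xpd.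
- exact: integrableZl.
Qed.

Lemma singular_piece g mu p c d e M : 0 < mu <= 1 -> p <= c <= d -> d <= e ->
  0 <= M -> {within `[p, e], continuous g} ->
  (forall x, p <= x <= e -> g x <= M) ->
  \int[leb]_(x in `]c, d]) ((x - p) `^ (mu - 1) * g x) <=
  M * ((d - c) `^ mu / mu).
Proof.
move=> mu01 /andP[pc cd] de M0 cg gM.
have sub : `]c, d]%classic `<=` `]p, e]%classic.
  move=> x /=; rewrite !in_itv/= => /andP[cx xd].
  by rewrite (le_lt_trans pc)//= (le_trans xd).
have pe : p <= e by rewrite (le_trans pc)// (le_trans cd).
have iw : leb.-integrable `]c, d] (EFin \o (fun x => (x - p) `^ (mu - 1))).
  by apply: integrableS (integrable_power _ _ _ mu01 pe).
have iwg : leb.-integrable `]c, d] (EFin \o (fun x => (x - p) `^ (mu - 1) * g x)).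
  by apply: integrableS (integrable_power_mul _ _ _ _ mu01 pe cg).
have iMw : leb.-integrable `]c, d] (EFin \o (fun x => M * (x - p) `^ (mu - 1))).
  rewrite [X in leb.-integrable _ X](_ : _ =
    (fun x => M%:E * (EFin \o (fun x => (x - p) `^ (mu - 1))%R) x)%E)//.
  exact: integrableZl.
apply: (@le_trans _ _ (\int[leb]_(x in `]c, d]) (M * (x - p) `^ (mu - 1)))).
  apply: le_Rintegral => // x /sub; rewrite /= in_itv/= => /andP[px xe].
  by rewrite mulrC ler_wpM2r ?powR_ge0// gM// xe ltW.
rewrite RintegralZl// ler_wpM2l// Rintegral_power_le// pc//.
Qed.

(** On such an interval |om psi'| >= lam = om m del^(rho - 1) and the weight is
    at most del^(mu - 1), and del^(mu - 1) / lam = del^mu / m because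
    om del^rho = 1. *)
Lemma nonstationary_piece (I : set R) (psi psit P P' Q Q' h : R -> R)
    p0 p a b mu rho om del M m :
  assumption_P I p0 rho psi psit ->
  monotone_on [set x | I x /\ x < p0] (psi^`()%classic) ->
  monotone_on [set x | I x /\ p0 < x] (psi^`()%classic) ->
  1 < rho -> 0 < mu <= 1 -> 0 < om -> 0 < del -> om * del `^ rho = 1 ->
  0 < m -> 0 <= M -> a < b -> `[a, b] `<=` I ->
  del <= a - p -> b <= p0 - del \/ p0 + del <= a ->
  (forall x, a <= x <= b -> m <= `|psit x|) ->
  {within `[a, b], continuous P} ->
  {within `[a, b], continuous Q} ->
  (forall x, a < x < b -> is_derive x 1 P (P' x)) ->
  (forall x, a < x < b -> is_derive x 1 Q (Q' x)) ->
  (forall x, a <= x <= b -> P x ^+ 2 + Q x ^+ 2 <= M ^+ 2) ->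
  leb.-integrable `]a, b[ (EFin \o h) ->
  (forall x, a < x < b -> 0 <= h x) ->
  (forall x, a < x < b -> P' x ^+ 2 + Q' x ^+ 2 <= h x ^+ 2) ->
  \int[leb]_(x in `]a, b]) ((x - p) `^ (mu - 1) *
     (P x * cos (om * psi x) + Q x * sin (om * psi x))) <=
    (4 * M + \int[leb]_(x in `]a, b[) h x) / m * del `^ mu.
Proof.
move=> [[dpsi cpsi'] [_ [dpsi' _]] psi'E _ _] monl monr rho1 /andP[mu0 mu1].
move=> om0 del0 omdel m0 M0 ab abI dela sep mpsit cP cQ dP dQ PQM ih h0 P'Q'h.
have Iab x : a <= x <= b -> I x by move=> axb; apply: abI; rewrite /= in_itv.
have ooW x : a < x < b -> a <= x <= b by move=> /andP[/ltW -> /ltW ->].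
have del_p0 x : a <= x <= b -> del <= `|x - p0|.
  move=> /andP[ax xb]; case: sep => H; last by rewrite ler_normr; lra.
  by rewrite distrC ler_normr; lra.
have np0 x : a <= x <= b -> x != p0.
  move=> /del_p0; apply: contraTneq => ->.
  by rewrite subrr normr0 -ltNge.
have dpsix x : I x -> is_derive x 1 psi (psi^`()%classic x).
  by move=> Ix; rewrite derive1E; apply: DeriveDef => //; exact: dpsi.
have dpsi'x x : a <= x <= b ->
    is_derive x 1 (psi^`()%classic) (psi^`()%classic^`()%classic x).
  move=> axb; rewrite [X in is_derive _ _ _ X]derive1E; apply: DeriveDef => //.
  by apply: dpsi'; split; [exact: Iab|apply/eqP/np0].
pose lam := om * (m * del `^ (rho - 1)).
have lam0 : 0 < lam by rewrite !mulr_gt0// powR_gt0.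
have ap0 : 0 < a - p by exact: lt_le_trans dela.
have px x : a <= x -> p < x by rewrite subr_gt0 in ap0; exact: lt_le_trans.
pose W x := (x - p) `^ (mu - 1).
have Wle x y : p < x -> x <= y -> W y <= W x.
  move=> pltx xy; have xp0 : 0 < x - p by rewrite subr_gt0.
  have yp0 : 0 < y - p by rewrite subr_gt0 (lt_le_trans pltx).
  have -> : W x = ((x - p) `^ (1 - mu))^-1 by rewrite -powRN opprB.
  have -> : W y = ((y - p) `^ (1 - mu))^-1 by rewrite -powRN opprB.
  rewrite lef_pV2 ?posrE ?powR_gt0//.
  by apply: ge0_ler_powR; rewrite ?nnegrE; lra.
have sgn : (forall x, a < x < b -> om * psi^`()%classic^`()%classic x <= 0) \/
    (forall x, a < x < b -> 0 <= om * psi^`()%classic^`()%classic x).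
  suff [H|H] : (forall x, a < x < b -> psi^`()%classic^`()%classic x <= 0) \/
    (forall x, a < x < b -> 0 <= psi^`()%classic^`()%classic x).
  - by left => x /H; rewrite pmulr_rle0.
  - by right => x /H; rewrite pmulr_rge0.
  have dd x : a < x < b ->
      is_derive x 1 (psi^`()%classic) (psi^`()%classic^`()%classic x).
    by move=> /ooW; exact: dpsi'x.
  case: sep => H.
    apply: monotone_is_derive_sign monl _ dd => x axb.
    by split; [exact/Iab/ooW|case/andP: axb; lra].
  apply: monotone_is_derive_sign monr _ dd => x axb.
  by split; [exact/Iab/ooW|case/andP: axb; lra].
have cont (g g' : R -> R) : (forall x, a <= x <= b -> is_derive x 1 g (g' x)) ->
    {within `[a, b], continuous g}.
  move=> dg; apply: derivable_within_continuous => x; rewrite in_itv/= => axb.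
  by have := dg _ axb => ?; exact: ex_derive.
have omd (g : R -> R) l x : is_derive x 1 g l ->
    is_derive x 1 (fun x => om * g x) (om * l).
  move=> dg.
  have : is_derive x 1 (om \*: g) (om *: l) by typeclasses eauto.
  by [].
have step : \int[leb]_(x in `]a, b]) (W x *
     (P x * cos (om * psi x) + Q x * sin (om * psi x))) <=
    W a / lam * (4 * M + \int[leb]_(x in `]a, b[) h x).
  apply: (oscillatory_piece a b W (fun x => (mu - 1) * (x - p) `^ (mu - 1 - 1))
    P P' Q Q' (fun x => om * psi x) (fun x => om * psi^`()%classic x)
    (fun x => om * psi^`()%classic^`()%classic x) h M lam) => //.
  - apply: (cont _ (fun x => (mu - 1) * (x - p) `^ (mu - 1 - 1))) => x /andP[ax _].
    exact/is_derive_power_shift/px.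
  - apply: (cont _ (fun x => om * psi^`()%classic x)) => x axb.
    by apply/omd/dpsix/Iab.
  - apply: (cont _ (fun x => om * psi^`()%classic^`()%classic x)) => x axb.
    exact/omd/dpsi'x.
  - by move=> x /andP[/ltW ax _]; exact/is_derive_power_shift/px.
  - by move=> x /ooW axb; exact/omd/dpsix/Iab.
  - by move=> x /ooW axb; exact/omd/dpsi'x.
  - by move=> x /andP[ax _]; rewrite powR_ge0/= Wle// px.
  - by move=> x _; rewrite mulr_le0_ge0 ?powR_ge0// subr_le0.
  - move=> x axb; rewrite normrM (gtr0_norm om0) ler_pM2l// (psi'E _ (Iab _ axb)).
    rewrite normrM (ger0_norm (powR_ge0 _ _)) mulrC.
    apply: ler_pM; rewrite ?powR_ge0 ?(ltW m0) ?mpsit//.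
    by apply: ge0_ler_powR; rewrite ?nnegrE ?subr_ge0 ?del_p0 ?(ltW rho1) ?(ltW del0).
have H0 : 0 <= 4 * M + \int[leb]_(x in `]a, b[) h x.
  by rewrite addr_ge0 ?mulr_ge0// Rintegral_ge0// => x; rewrite /= in_itv; exact: h0.
apply: (le_trans step); rewrite mulrC -mulrA ler_wpM2l//.
have Wdel : W a <= del `^ (mu - 1).
  have -> : del = (p + del) - p by rewrite addrAC subrr add0r.
  by apply: Wle; lra.
apply: (@le_trans _ _ (del `^ (mu - 1) / lam)).
  by rewrite ler_wpM2r// invr_ge0 ltW.
rewrite ler_pdivrMr// /lam.
have delE s : del `^ s = del `^ (s - 1) * del.
  have := @powRD _ del (s - 1) 1.
  by rewrite subrK powRr1 ?(ltW del0)// => ->//; rewrite (gt_eqF del0) implybT.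
have delrho : om * del `^ (rho - 1) * del = 1 by rewrite -mulrA -delE.
have -> : m^-1 * del `^ mu * (om * (m * del `^ (rho - 1))) =
    (m^-1 * m) * del `^ (mu - 1) * (om * del `^ (rho - 1) * del).
  by rewrite (delE mu); ring.
by rewrite delrho mulVf ?gt_eqF// mul1r mulr1.
Qed.

End Pieces.

(** * Splitting the interval of integration *)

Lemma min_on_le {R : realType} (f : R -> R) (a b x : R) :
  (forall y, 0 <= f y) -> a <= x <= b -> min_on `[a, b] f <= f x.
Proof.
move=> f0 axb; apply: ge_inf; first by exists 0 => _ [y _ <-].
by exists x => //=; rewrite in_itv.
Qed.

Lemma min_on_gt0 {R : realType} (f : R -> R) (a b : R) : a <= b ->
  {within `[a, b], continuous f} -> (forall y, a <= y <= b -> 0 < f y) ->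
  0 < min_on `[a, b] f.
Proof.
move=> ab cf f0; have [c cab fc] := EVT_min ab cf.
apply: (@lt_le_trans _ _ (f c)); first by apply: f0; rewrite in_itv in cab.
apply: lb_le_inf; first by exists (f c), c.
by move=> _ [y yab <-]; exact: fc.
Qed.

Lemma clampP {R : realType} (a b t : R) : a <= b ->
  [/\ a <= Num.max a (Num.min b t) <= b,
      a < Num.max a (Num.min b t) -> Num.max a (Num.min b t) <= t &
      Num.max a (Num.min b t) < b -> t <= Num.max a (Num.min b t)].
Proof.
move=> ab; case: (leP b t) => bt.
  rewrite (max_r ab); split; [by rewrite ab lexx|by []|by rewrite ltxx].
by case: (leP a t) => ta; split; rewrite ?lexx ?ltxx ?ta ?(ltW bt) ?ab ?(ltW ta).
Qed.

Lemma clamp_lipschitz {R : realType} (a b t t' : R) : a <= b -> t <= t' ->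
  Num.max a (Num.min b t) <= Num.max a (Num.min b t') <=
    Num.max a (Num.min b t) + (t' - t).
Proof.
move=> ab tt'; case: (leP b t) => bt; case: (leP b t') => bt';
  rewrite ?(max_r ab); try (case: (leP a t) => ta); try (case: (leP a t') => ta');
  by apply/andP; split; lra.
Qed.

Theorem theorem2p1 (R : realType) (p1 p2 : R) (I : set R) (rho mu p0 : R)
    (psi psit : R -> R) (U u : R -> Cplx R)
    (hp : p1 < p2)
    (hIopen : open I) (hIitv : is_interval I) (hI : `[p1, p2] `<=` I)
    (hrho : 1 < rho) (hmu : 0 < mu <= 1) (hp0 : I p0)
    (hP : assumption_P I p0 rho psi psit)
    (hA : assumption_A p1 p2 mu U u)
    (hmonl : monotone_on [set p | I p /\ p < p0] (psi^`()%classic))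
    (hmonr : monotone_on [set p | I p /\ p0 < p] (psi^`()%classic)) :
  forall omega : R, 0 < omega ->
    cmod (cintegral `]p1, p2] (fun p => U p * expi (omega * psi p))) <=
      (3 / mu * cLnorm `]p1, p2[ +oo%E u +
       (8 * cLnorm `]p1, p2[ +oo%E u + 2 * cLnorm `]p1, p2[ 1%E (cderive u)) *
       (min_on `[p1, p2] (fun p => `|psit p|))^-1) *
      omega `^ (- (mu / rho)).
Proof.
move=> om om0; have mu0 : 0 < mu by case/andP: hmu.
case: (hP) => -[dpsi cpsi'] _ psi'E cpsit psit0.
case: (hA) => Uu cu du iu' _.
have rho0 : 0 < rho by exact: lt_trans hrho.
set M := cLnorm _ +oo%E u; set N := cLnorm _ 1%E _; set m := min_on _ _.
have p12 : p1 <= p2 by exact: ltW.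
have J_I x : p1 <= x <= p2 -> I x by move=> Jx; apply: hI; rewrite /= in_itv.
have mpsit x : p1 <= x <= p2 -> m <= `|psit x|.
  by move=> Jx; apply: (min_on_le (fun x => `|psit x|)).
have m0 : 0 < m.
  apply: min_on_gt0 => //; first exact: continuous_subspaceW cpsit.
  by move=> y Jy; rewrite normr_gt0; exact/psit0/J_I.
have uM x : p1 <= x <= p2 -> cmod (u x) <= M.
  by move=> Jx; exact: cmod_le_cLnormy.
have M0 : 0 <= M.
  by apply: le_trans (cmod_ge0 _) (uM p1 _); rewrite lexx.
pose h x := cmod (cderive u x).
have ih : lebesgue_measure.-integrable `]p1, p2[ (EFin \o h) by exact: integrable_cmod.
pose del := om `^ (- rho^-1).
have del0 : 0 < del by exact: powR_gt0.
have omdel : om * del `^ rho = 1.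
  rewrite -powRrM mulNr mulVf ?gt_eqF// powR_inv1 ?(ltW om0)// divff//.
  by rewrite gt_eqF.
have delmu : om `^ (- (mu / rho)) = del `^ mu.
  by rewrite -powRrM mulNr mulrC.
have cRe := within_continuous_Re _ _ cu.
have cIm := within_continuous_Im _ _ cu.
have cpsi : {within `[p1, p2], continuous psi}.
  apply: derivable_within_continuous => x; rewrite in_itv/= => Jx.
  exact/dpsi/J_I.
have cphase : {within `[p1, p2], continuous (fun x => om * psi x)}.
  by move=> x; apply: cvgMr; exact: cpsi.
have ccos : {within `[p1, p2], continuous (fun x => cos (om * psi x))}.
  by move=> x; exact: (cvg_comp _ _ (cphase x) (@continuous_cos R (om * psi x))).
have csin : {within `[p1, p2], continuous (fun x => sin (om * psi x))}.
  by move=> x; exact: (cvg_comp _ _ (cphase x) (@continuous_sin R (om * psi x))).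
apply: cmod_le_rotation => c s cs1.
pose w x := (x - p1) `^ (mu - 1).
pose P x := c * complex.Re (u x) + s * complex.Im (u x).
pose Q x := s * complex.Re (u x) - c * complex.Im (u x).
pose g x := P x * cos (om * psi x) + Q x * sin (om * psi x).
have cP : {within `[p1, p2], continuous P}.
  by move=> x; apply: cvgD; apply: cvgMr; [exact: cRe|exact: cIm].
have cQ : {within `[p1, p2], continuous Q}.
  by move=> x; apply: cvgB; apply: cvgMr; [exact: cRe|exact: cIm].
have cg : {within `[p1, p2], continuous g}.
  move=> x; apply: cvgD.
    by apply: cvgM; [exact: cP|exact: ccos].
  by apply: cvgM; [exact: cQ|exact: csin].
have iwg := integrable_power_mul _ _ _ _ hmu p12 cg.
have rot (z : Cplx R) : (c * complex.Re z + s * complex.Im z) ^+ 2 +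
    (s * complex.Re z - c * complex.Im z) ^+ 2 = cmod z ^+ 2.
  by rewrite cmod_sqr -[RHS]mul1r -cs1; ring.
have PQM x : p1 <= x <= p2 -> P x ^+ 2 + Q x ^+ 2 <= M ^+ 2.
  by move=> Jx; rewrite rot ler_pXn2r ?nnegrE ?cmod_ge0 ?uM.
have gM x : p1 <= x <= p2 -> g x <= M.
  move=> Jx; apply: le_trans (ler_norm _) _.
  have := @normr_le_cross R (P x) (Q x) (- sin (om * psi x)) (cos (om * psi x))
    M M0 (PQM _ Jx).
  by rewrite sqrrN addrC cos2Dsin2 mulrN opprK; exact.
have -> : c * complex.Re (cintegral `]p1, p2] (fun p => U p * expi (om * psi p))) +
    s * complex.Im (cintegral `]p1, p2] (fun p => U p * expi (om * psi p))) =
    \int[lebesgue_measure]_(x in `]p1, p2]) (w x * g x).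
  pose gR x := complex.Re (u x) * cos (om * psi x) - complex.Im (u x) * sin (om * psi x).
  pose gI x := complex.Re (u x) * sin (om * psi x) + complex.Im (u x) * cos (om * psi x).
  have cgR : {within `[p1, p2], continuous gR}.
    move=> x; apply: cvgB.
      by apply: cvgM; [exact: cRe|exact: ccos].
    by apply: cvgM; [exact: cIm|exact: csin].
  have cgI : {within `[p1, p2], continuous gI}.
    move=> x; apply: cvgD.
      by apply: cvgM; [exact: cRe|exact: csin].
    by apply: cvgM; [exact: cIm|exact: ccos].
  have igR := integrable_power_mul _ _ _ _ hmu p12 cgR.
  have igI := integrable_power_mul _ _ _ _ hmu p12 cgI.
  have UE x : p1 < x <= p2 ->
      complex.Re (U x * expi (om * psi x)) = w x * gR x /\
      complex.Im (U x * expi (om * psi x)) = w x * gI x.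
    move=> xJ; rewrite Uu// -mulrA.
    have [-> ->] := ReImMr (w x) (u x * expi (om * psi x)).
    by rewrite /gR /gI /expi; case: (u x).
  have ReE : \int[lebesgue_measure]_(x in `]p1, p2])
        complex.Re (U x * expi (om * psi x)) =
      \int[lebesgue_measure]_(x in `]p1, p2]) (w x * gR x).
    by apply: eq_Rintegral => x; rewrite inE/= in_itv/= => /UE[].
  have ImE : \int[lebesgue_measure]_(x in `]p1, p2])
        complex.Im (U x * expi (om * psi x)) =
      \int[lebesgue_measure]_(x in `]p1, p2]) (w x * gI x).
    by apply: eq_Rintegral => x; rewrite inE/= in_itv/= => /UE[].
  rewrite /cintegral/= ReE ImE.
  rewrite -!RintegralZl//.
  have iZ k (f : R -> R) : lebesgue_measure.-integrable `]p1, p2] (EFin \o f) ->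
      lebesgue_measure.-integrable `]p1, p2] (EFin \o (fun x => k * f x)).
    move=> fi; rewrite [X in lebesgue_measure.-integrable _ X](_ : _ =
      (fun x => k%:E * (EFin \o f) x)%E)//.
    exact: integrableZl.
  rewrite -RintegralD//; [|exact: iZ|exact: iZ].
  by apply: eq_Rintegral => x _; rewrite /g /P /Q /gR /gI; ring.
(* ]p1, q1] and ]q2, q3] are the pieces near p1 and p0, and ]q1, q2] and
   ]q3, p2] the remaining ones; clamping q2 and q3 to [q1, p2] makes
   the pieces that are absent empty, as when p0 is close to p1 or lies
   outside the interval. *)
pose q1 := Num.min (p1 + del) p2.
pose q2 := Num.max q1 (Num.min p2 (p0 - del)).
pose q3 := Num.max q1 (Num.min p2 (p0 + del)).
have q1P : [/\ p1 < q1, q1 <= p1 + del, q1 <= p2 & q1 < p2 -> q1 = p1 + del].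
  rewrite /q1; case: (leP (p1 + del) p2) => H; split => //; lra.
case: q1P => p1q1 q1del q1p2 q1E.
have q23 : q2 <= q3 <= q2 + ((p0 + del) - (p0 - del)).
  by apply: clamp_lipschitz => //; lra.
have [/andP[q12 q2p2] q2l _] : [/\ q1 <= q2 <= p2,
    q1 < q2 -> q2 <= p0 - del & q2 < p2 -> p0 - del <= q2] by exact: clampP.
have [/andP[q13 q3p2] _ q3l] : [/\ q1 <= q3 <= p2,
    q1 < q3 -> q3 <= p0 + del & q3 < p2 -> p0 + del <= q3] by exact: clampP.
clearbody q2 q3; clearbody q1.
case/andP: q23 => q23 q32.
have isub a : p1 <= a ->
    lebesgue_measure.-integrable `]a, p2] (EFin \o (fun x => w x * g x)).
  move=> p1a; apply: integrableS iwg => // x /=; rewrite !in_itv/=.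
  by move=> /andP[ax ->]; rewrite (le_lt_trans p1a).
rewrite (@Rintegral_itv_oc_split _ _ p1 q1 p2) ?(ltW p1q1)//.
rewrite (@Rintegral_itv_oc_split _ _ q1 q2 p2) ?q12//; last exact/isub/ltW.
rewrite (@Rintegral_itv_oc_split _ _ q2 q3 p2) ?q23//; last first.
  by apply: isub; rewrite (le_trans _ q12)// ltW.
have bound0 : 0 <= (4 * M + N) / m * del `^ mu.
  rewrite mulr_ge0 ?powR_ge0// divr_ge0 ?(ltW m0)// addr_ge0 ?mulr_ge0//.
  by rewrite /N cLnorm1E Rintegral_ge0// => x _; exact: cmod_ge0.
have good a b : q1 <= a -> a <= b -> b <= p2 ->
    (a < b -> b <= p0 - del \/ p0 + del <= a) ->
    \int[lebesgue_measure]_(x in `]a, b]) (w x * g x) <= (4 * M + N) / m * del `^ mu.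
  move=> q1a; rewrite le_eqVlt => /predU1P[<- _ _|ab bp2 /(_ ab) sep].
    by rewrite set_itvxx Rintegral_set0.
  have aE : p1 + del <= a by rewrite -q1E// (le_lt_trans q1a)// (lt_le_trans ab).
  have p1a : p1 < a by rewrite (lt_le_trans p1q1).
  have subJ x : a <= x <= b -> p1 <= x <= p2.
    by move=> /andP[ax xb]; rewrite (le_trans (ltW p1a))//= (le_trans xb).
  have subJo x : a < x < b -> p1 < x < p2.
    by move=> /andP[ax xb]; rewrite (lt_trans p1a)//= (lt_le_trans xb).
  have ihab : lebesgue_measure.-integrable `]a, b[ (EFin \o h).
    by apply: integrableS ih => // x /=; rewrite !in_itv/=; exact: subJo.
  have subW (f : R -> R) : {within `[p1, p2], continuous f} ->
      {within `[a, b], continuous f}.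
    by apply: continuous_subspaceW => x /=; rewrite !in_itv/=; exact: subJ.
  have dRe x : a < x < b ->
      is_derive x 1 (fun y => complex.Re (u y)) (complex.Re (cderive u x)).
    by move=> /subJo /du; exact: is_derive_Re.
  have dIm x : a < x < b ->
      is_derive x 1 (fun y => complex.Im (u y)) (complex.Im (cderive u x)).
    by move=> /subJo /du; exact: is_derive_Im.
  apply: (@le_trans _ _
      ((4 * M + \int[lebesgue_measure]_(x in `]a, b[) h x) / m * del `^ mu)).
    apply: (nonstationary_piece I psi psit P
      (fun x => c * complex.Re (cderive u x) + s * complex.Im (cderive u x)) Q
      (fun x => s * complex.Re (cderive u x) - c * complex.Im (cderive u x)) h
      p0 p1 a b mu rho om del M m) => //.
    - by move=> x /=; rewrite in_itv/= => /subJ; exact: J_I.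
    - by lra.
    - by move=> x /subJ; exact: mpsit.
    - exact: subW.
    - exact: subW.
    - move=> x axb; have := dRe _ axb => ?; have := dIm _ axb => ?.
      have : is_derive x 1
        (c \*: (fun y => complex.Re (u y)) + s \*: (fun y => complex.Im (u y)))
        (c *: complex.Re (cderive u x) + s *: complex.Im (cderive u x)).
        by typeclasses eauto.
      by [].
    - move=> x axb; have := dRe _ axb => ?; have := dIm _ axb => ?.
      have : is_derive x 1
        (s \*: (fun y => complex.Re (u y)) - c \*: (fun y => complex.Im (u y)))
        (s *: complex.Re (cderive u x) - c *: complex.Im (cderive u x)).
        by typeclasses eauto.
      by [].
    - by move=> x /subJ; exact: PQM.
    - by move=> x _; exact: cmod_ge0.
    - by move=> x _; rewrite rot.
  rewrite ler_wpM2r ?powR_ge0// ler_wpM2r ?invr_ge0 ?(ltW m0)// lerD2l /N cLnorm1E.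
  rewrite fine_le ?integrable_fin_num//.
  apply: ge0_subset_integral => //.
  - exact: measurable_int ih.
  - by move=> x _; rewrite lee_fin cmod_ge0.
have bad1 : \int[lebesgue_measure]_(x in `]p1, q1]) (w x * g x) <=
    M * (del `^ mu / mu).
  apply: (le_trans (singular_piece g mu p1 p1 q1 p2 M _ _ _ _ _ _)) => //.
    by rewrite lexx ltW.
  rewrite ler_wpM2l// ler_wpM2r ?invr_ge0 ?(ltW mu0)//.
  by apply: ge0_ler_powR; rewrite ?nnegrE; lra.
have bad2 : \int[lebesgue_measure]_(x in `]q2, q3]) (w x * g x) <=
    M * (2 * del `^ mu / mu).
  apply: (le_trans (singular_piece g mu p1 q2 q3 p2 M _ _ _ _ _ _)) => //.
    by rewrite q23 andbT (le_trans (ltW p1q1)).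
  rewrite ler_wpM2l// ler_wpM2r ?invr_ge0 ?(ltW mu0)//.
  apply: (@le_trans _ _ ((2 * del) `^ mu)).
    by apply: ge0_ler_powR; rewrite ?nnegrE; lra.
  rewrite powRM ?(ltW del0)// ler_wpM2r ?powR_ge0// -[leRHS]powRr1//.
  by apply: ler_powR; [lra|case/andP: hmu].
have good1 := good _ _ (lexx q1) q12 q2p2 (fun H => or_introl (q2l H)).
have good2 := good _ _ q13 q3p2 (lexx p2) (fun H => or_intror (q3l H)).
rewrite delmu.
have -> : (3 / mu * M + (8 * M + 2 * N) / m) * del `^ mu =
  M * (del `^ mu / mu) + ((4 * M + N) / m * del `^ mu +
    (M * (2 * del `^ mu / mu) + (4 * M + N) / m * del `^ mu)) by ring.
by rewrite !lerD.
Qed.
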